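(* Let $M^3(\phi,\xi,\eta,g)$ be an $\alpha$-para Kenmotsu manifold. If $T$ is a second order parallel tensor on $M^3$, i.e. a $(0,2)$-tensor field with $\nabla T=0$, then $T$ is a constant multiple of the associated metric: there is a constant $c\in\mathbb{R}$ such that $T=c\,g$.
   Context: All manifolds are smooth and connected. An almost paracontact metric structure on a 3-manifold $M^3$ is a quadruple $(\phi,\xi,\eta,g)$, where $\phi$ is a $(1,1)$-tensor field, $\xi$ a vector field, $\eta$ a 1-form and $g$ a pseudo-Riemannian metric of signature $(2,1)$, with $\phi^2=I-\eta\otimes\xi$, $\eta(\xi)=1$, the eigendistributions of $\phi$ restricted to $D=\ker\eta$ for the eigenvalues $+1$ and $-1$ having equal rank $1$, and $g(\phi X,\phi Y)=-g(X,Y)+\eta(X)\eta(Y)$ for all $X,Y$. Consequently $\phi\xi=0$, $\eta\circ\phi=0$, $\eta(X)=g(X,\xi)$ and $g(\phi X,Y)=-g(X,\phi Y)$. The structure is normal if $[\phi,\phi]-2d\eta\otimes\xi=0$, where $[\phi,\phi](X,Y)=\phi^2[X,Y]+[\phi X,\phi Y]-\phi[\phi X,Y]-\phi[X,\phi Y]$ and $2d\eta(X,Y)=X\eta(Y)-Y\eta(X)-\eta([X,Y])$. In dimension 3 it is known that normality is equivalent to the existence of smooth functions $\alpha,\beta$ with $\nabla_X\xi=\alpha(X-\eta(X)\xi)+\beta\phi X$ for all $X$, and also equivalent to $(\nabla_X\phi)Y=\beta(g(X,Y)\xi-\eta(Y)X)+\alpha(g(\phi X,Y)\xi-\eta(Y)\phi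 X)$ for all $X,Y$ (same functions $\alpha,\beta$), where $\nabla$ is the Levi-Civita connection of $g$; here $2\alpha=\mathrm{trace}\{X\mapsto\nabla_X\xi\}$ and $2\beta=\mathrm{trace}\{X\mapsto\phi\nabla_X\xi\}$. A normal almost paracontact metric 3-manifold is called $\alpha$-para Kenmotsu if $\alpha$ is a non-zero constant and $\beta=0$. A tensor $T$ of second order is called a second order parallel tensor if $\nabla T=0$. *)

(* Defs.v *)
(* Smooth 3-manifolds given by charts; over them, differential geometry in
   index-free form: tangent vectors at p are the derivations of C^oo(M) at p,
   vector fields are the derivations of C^oo(M), and tensor fields are the
   C^oo(M)-multilinear maps on the C^oo(M)-module of vector fields. *)
From HB Require Import structures.
From mathcomp Require Import all_boot all_order all_algebra.
From mathcomp Require Import all_classical all_reals all_analysis ring.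

Set Implicit Arguments.
Unset Strict Implicit.
Unset Printing Implicit Defensive.

Import Order.TTheory GRing.Theory Num.Theory.
Import numFieldNormedType.Exports.

Local Open Scope classical_set_scope.
Local Open Scope ring_scope.

(* f is C^k on the open set U.  U has to be open: continuity and 'D_v f are
   those of the total function f, hence depend on its germ at x. *)
Fixpoint Ck (R : realType) (n : nat) (W : normedModType R) (k : nat)
    (U : set 'rV[R]_n.+1) (f : 'rV[R]_n.+1 -> W) : Prop :=
  {in U, continuous f} /\
  match k with
  | 0%N => True
  | k'.+1 => forall v, {in U, forall x, derivable f x v} /\ Ck k' U ('D_v f)
  end.

Definition smooth_on (R : realType) (n : nat) (W : normedModType R)
    (U : set 'rV[R]_n.+1) (f : 'rV[R]_n.+1 -> W) : Prop :=
  forall k, Ck k U f.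

Section CkTheory.
Variables (R : realType) (n : nat).
Notation V := 'rV[R]_n.+1.
Variable (U : set V).
Hypothesis (oU : open U).

Lemma open_near_eq (W : Type) (f g : V -> W) x :
  {in U, f =1 g} -> x \in U -> {near x, f =1 g}.
Proof.
move=> fg /set_mem Ux; apply: (@filterS _ _ _ U); last exact: open_nbhs_nbhs.
by move=> y Uy; apply/fg/mem_set.
Qed.

Lemma Ck_eq (W : normedModType R) k (f g : V -> W) :
  {in U, f =1 g} -> Ck k U f -> Ck k U g.
Proof.
elim: k f g => [|k IHk] f g fg /= [cf Df].
  split=> // x xU; rewrite /prop_for /continuous_at -(fg x xU).
  exact: cvg_trans (near_eq_cvg (open_near_eq fg xU)) (cf x xU).
split=> [x xU|v].
  rewrite /prop_for /continuous_at -(fg x xU).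
  exact: cvg_trans (near_eq_cvg (open_near_eq fg xU)) (cf x xU).
have [df kf] := Df v; split=> [x xU|].
  exact: near_eq_derivable (open_near_eq fg xU) (df x xU).
by apply: IHk kf => x xU; exact: near_eq_derive (open_near_eq fg xU).
Qed.

Lemma CkS (W : normedModType R) k (f : V -> W) : Ck k.+1 U f -> Ck k U f.
Proof.
elim: k f => [|k IHk] f [cf Df]; first by split.
by split=> // v; have [df kf] := Df v; split=> //; exact: IHk.
Qed.

Lemma Ck_cst (W : normedModType R) k (a : W) : Ck k U (cst a : V -> W).
Proof.
have c0 (b : W) : {in U, continuous (cst b : V -> W)}.
  by move=> x _; exact: cst_continuous.
elim: k a => [|k IHk] a; split=> // v; split=> [x _|]; first exact: derivable_cst.
by rewrite (_ : 'D_v _ = cst 0) //; apply/funext => x; rewrite derive_cst.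
Qed.

Lemma CkD (W : normedModType R) k (f g : V -> W) :
  Ck k U f -> Ck k U g -> Ck k U (f + g).
Proof.
elim: k f g => [|k IHk] f g [cf Df] [cg Dg]; split=> //.
- by move=> x xU; exact: (cvgD (cf x xU) (cg x xU)).
- by move=> x xU; exact: (cvgD (cf x xU) (cg x xU)).
move=> v; have [df kf] := Df v; have [dg kg] := Dg v; split=> [x xU|].
  by apply: derivableD; [exact: df|exact: dg].
apply: Ck_eq (IHk _ _ kf kg) => x xU.
by rewrite deriveD; [|exact: df|exact: dg].
Qed.

Lemma CkM k (f g : V -> R) : Ck k U f -> Ck k U g -> Ck k U (f * g).
Proof.
elim: k f g => [|k IHk] f g; first move=> [cf Df] [cg Dg]; last first.
  move=> kf kg; have kf' := CkS kf; have kg' := CkS kg.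
  move: kf kg => [cf Df] [cg Dg].
  split=> [x xU|v]; first by exact: (cvgM (cf x xU) (cg x xU)).
  have [df kdf] := Df v; have [dg kdg] := Dg v; split=> [x xU|].
    by apply: derivableM; [exact: df|exact: dg].
  apply: Ck_eq (CkD (IHk _ _ kf' kdg) (IHk _ _ kg' kdf)) => x xU.
  by rewrite deriveM; [|exact: df|exact: dg].
by split=> // x xU; exact: (cvgM (cf x xU) (cg x xU)).
Qed.

End CkTheory.

Record chart (R : realType) (M : topologicalType) := Chart {
  chart_dom : set M;
  chart_map : M -> 'rV[R]_3;
  chart_inv : 'rV[R]_3 -> M;
  chart_dom_open : open chart_dom;
  chart_cod_open : open (chart_map @` chart_dom);
  chart_mapK : {in chart_dom, cancel chart_map chart_inv};
  chart_map_continuous : {in chart_dom, continuous chart_map};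
  chart_inv_continuous : {in chart_map @` chart_dom, continuous chart_inv} }.

Arguments chart_dom_open {R M} c.
Arguments chart_cod_open {R M} c.

(* The atlas need not be maximal: it has the same smooth functions as the
   maximal atlas containing it. *)
Record manifold3 (R : realType) := Manifold3 {
  carrier :> topologicalType;
  manifold_hausdorff : hausdorff_space carrier;
  manifold_second_countable : @second_countable carrier;
  manifold_connected : connected [set: carrier];
  atlas : set (chart R carrier);
  atlas_cover : forall p, exists2 c, atlas c & chart_dom c p;
  atlas_compatible : forall c d, atlas c -> atlas d ->
    smooth_on (chart_map c @` (chart_dom c `&` chart_dom d))
              (chart_map d \o chart_inv c) }.

Section SmoothFunctions.
Variables (R : realType) (M : manifold3 R).

Definition smooth_fun : {pred M -> R} :=
  mem [set f : M -> R | forall c, atlas c ->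
    smooth_on (chart_map c @` chart_dom c) (f \o chart_inv c)].

Lemma smooth_subring_closed : subring_closed smooth_fun.
Proof.
split=> [|f g|f g]; rewrite ?inE /=.
- by move=> c _ k; exact: Ck_cst.
- move=> sf sg c Ac k; have oc := chart_cod_open c.
  rewrite (_ : _ \o _ = (f \o chart_inv c) + (cst (-1) * (g \o chart_inv c))).
    by apply: (CkD oc (sf c Ac k)); apply: (CkM oc) (sg c Ac k); exact: Ck_cst.
  by apply/funext => x /=; rewrite !fctE mulN1r.
- by move=> sf sg c Ac k; exact: (CkM (chart_cod_open c) (sf c Ac k) (sg c Ac k)).
Qed.

Lemma smooth_submod_closed : submod_closed smooth_fun.
Proof.
split=> [|a f g]; rewrite ?inE /=.
  by move=> c _ k; exact: Ck_cst.
move=> sf sg c Ac k; have oc := chart_cod_open c.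
rewrite (_ : _ \o _ = (cst a * (f \o chart_inv c)) + (g \o chart_inv c)) //.
by apply: (CkD oc) (sg c Ac k); apply: (CkM oc) (sf c Ac k); exact: Ck_cst.
Qed.

HB.instance Definition _ :=
  GRing.isSubringClosed.Build _ smooth_fun smooth_subring_closed.
HB.instance Definition _ :=
  GRing.isSubmodClosed.Build _ _ smooth_fun smooth_submod_closed.

(* C^oo(M) *)
Record Cinf := MkCinf { Cinf_fun :> M -> R; Cinf_smooth : Cinf_fun \in smooth_fun }.

HB.instance Definition _ := [isSub for Cinf_fun].
HB.instance Definition _ := [Choice of Cinf by <:].
HB.instance Definition _ :=
  GRing.SubChoice_isSubComPzRing.Build _ _ Cinf (subringClosedP _).
HB.instance Definition _ := [SubZmodule_isSubLmodule of Cinf by <:].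

Lemma CinfP (f g : Cinf) : f =1 g -> f = g.
Proof. by move=> fg; apply/val_inj/funext. Qed.

Lemma CinfD (f g : Cinf) p : (f + g) p = f p + g p. Proof. by []. Qed.
Lemma CinfB (f g : Cinf) p : (f - g) p = f p - g p. Proof. by []. Qed.
Lemma CinfM (f g : Cinf) p : (f * g) p = f p * g p. Proof. by []. Qed.
Lemma CinfZ (a : R) (f : Cinf) p : (a *: f) p = a * f p. Proof. by []. Qed.
Lemma Cinf0 p : (0 : Cinf) p = 0. Proof. by []. Qed.
Lemma Cinf1 p : (1 : Cinf) p = 1. Proof. by []. Qed.
Definition CinfE := (CinfB, CinfD, CinfM, CinfZ, Cinf0, Cinf1).

(* R-linear derivations of C^oo(M); the codomain is written Cinf^o so that
   they form a C^oo(M)-submodule of the functions Cinf -> Cinf^o. *)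
Definition derivation : {pred Cinf -> Cinf^o} :=
  mem [set X : Cinf -> Cinf |
       (forall (a : R) (f g : Cinf), X (a *: f + g) = a *: X f + X g) /\
       (forall f g : Cinf, X (f * g) = f * X g + g * X f)].

Lemma derivation_submod_closed : submod_closed derivation.
Proof.
split=> [|h X Y]; rewrite ?inE /=.
  by split=> [a f g|f g]; apply: CinfP => p; rewrite !CinfE; ring.
move=> [XL XM] [YL YM].
have E f : (h *: X + Y) f = h * (X f : Cinf) + (Y f : Cinf) by [].
split=> [a f g|f g]; rewrite !E ?XL ?YL ?XM ?YM; apply: CinfP => p;
  by rewrite !CinfE; ring.
Qed.

HB.instance Definition _ :=
  GRing.isSubmodClosed.Build _ _ derivation derivation_submod_closed.

Record vfield :=
  MkVfield { vfield_fun :> Cinf -> Cinf^o; vfieldP : vfield_fun \in derivation }.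

HB.instance Definition _ := [isSub for vfield_fun].
HB.instance Definition _ := [Choice of vfield by <:].
HB.instance Definition _ := [SubChoice_isSubLmodule of vfield by <:].

Definition bracket_fun (X Y : vfield) (f : Cinf) : Cinf^o := X (Y f) - Y (X f).

Lemma bracket_subproof X Y : bracket_fun X Y \in derivation.
Proof.
rewrite inE /= /bracket_fun.
have /set_mem[XL XM] := vfieldP X; have /set_mem[YL YM] := vfieldP Y.
have XD f g : X (f + g) = X f + X g by have := XL 1 f g; rewrite !scale1r.
have YD f g : Y (f + g) = Y f + Y g by have := YL 1 f g; rewrite !scale1r.
split=> [a f g|f g].
  by rewrite YL XL XL YL; apply: CinfP => p; rewrite !CinfE; ring.
by rewrite YM XM XD YD !XM !YM; apply: CinfP => p; rewrite !CinfE; ring.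
Qed.

Definition bracket X Y : vfield := MkVfield (bracket_subproof X Y).

Definition tangent_pred (p : M) : {pred Cinf -> R^o} :=
  mem [set v : Cinf -> R |
       (forall (a : R) (f g : Cinf), v (a *: f + g) = a * v f + v g) /\
       (forall f g : Cinf, v (f * g) = f p * v g + g p * v f)].

Lemma tangent_submod_closed p : submod_closed (tangent_pred p).
Proof.
split=> [|b u v]; rewrite ?inE /=.
  have E0 f : (0 : Cinf -> R^o) f = 0 :> R by [].
  by split=> [a f g|f g]; rewrite !E0 !mulr0 addr0.
move=> [uL uM] [vL vM].
have E f : (b *: u + v) f = b * (u f : R) + (v f : R) by [].
by split=> [a f g|f g]; rewrite !E ?uL ?vL ?uM ?vM; ring.
Qed.

HB.instance Definition _ p := GRing.isSubmodClosed.Build _ _ (tangent_pred p)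
  (tangent_submod_closed p).

(* T_p M *)
Record tangent (p : M) := MkTangent {
  tangent_fun :> Cinf -> R^o; tangentP : tangent_fun \in tangent_pred p }.

HB.instance Definition _ p := [isSub for @tangent_fun p].
HB.instance Definition _ p := [Choice of tangent p by <:].
HB.instance Definition _ p := [SubChoice_isSubLmodule of tangent p by <:].

Lemma value_subproof p (X : vfield) :
  (fun f => (X f : Cinf) p) \in tangent_pred p.
Proof.
rewrite inE /=; have /set_mem[XL XM] := vfieldP X.
by split=> [a f g|f g]; rewrite ?XL ?XM !CinfE.
Qed.

(* X_p *)
Definition value_at (p : M) (X : vfield) : tangent p :=
  MkTangent (value_subproof p X).

End SmoothFunctions.

Section Tensors.
Variables (R : realType) (M : manifold3 R).
Notation C := (Cinf M).
Notation X_M := (vfield M).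
Implicit Types (X Y Z : X_M) (f : C) (p : M).

(* The library's {bilinear _ -> _ -> _} requires nontrivial scalars, which
   C^oo(M) is not when M is empty. *)
Definition tensor02 (T : X_M -> X_M -> C) : Prop :=
  (forall Y, linear (T^~ Y : X_M -> C^o)) /\
  (forall X, linear (T X : X_M -> C^o)).

Definition frame_at p (E : 'I_3 -> X_M) : Prop :=
  forall v : tangent p, exists! a : 'rV[R]_3,
    v = \sum_i a ord0 i *: value_at p (E i).

(* signature (2,1): two positive and one negative direction; the values of g
   at p are computed on vector fields extending tangent vectors at p *)
Definition pseudo_metric_21 (g : X_M -> X_M -> C) : Prop :=
  [/\ tensor02 g,
      forall X Y, g X Y = g Y X &
      forall p, exists2 E : 'I_3 -> X_M, frame_at p E &
        forall i j, g (E i) (E j) p =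
          if i == j then (if (i < 2)%N then 1 else -1) else 0].

(* {v in T_p M | eta_p(v) = 0 and phi_p(v) = s v} *)
Definition eigendistribution (phi : X_M -> X_M) (eta : X_M -> C) (s : R) p :
    set (tangent p) :=
  [set v | exists X, [/\ value_at p X = v, eta X p = 0 &
                         value_at p (phi X) = s *: v]].

Definition rank1 p (L : set (tangent p)) : Prop :=
  exists2 v : tangent p, v != 0 & L = [set a *: v | a in [set: R]].

Record almost_paracontact_metric := AlmostParacontactMetric {
  phi : {linear X_M -> X_M};
  xi : X_M;
  eta : {linear X_M -> C^o};
  g : X_M -> X_M -> C;
  g_metric : pseudo_metric_21 g;
  phi_sqr : forall X, phi (phi X) = X - eta X *: xi;
  eta_xi : eta xi = 1;
  eigen_plus : forall p, rank1 (@eigendistribution phi eta 1 p);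
  eigen_minus : forall p, rank1 (@eigendistribution phi eta (-1) p);
  g_phi : forall X Y, g (phi X) (phi Y) = - g X Y + eta X * eta Y }.

Definition two_d_eta (eta : X_M -> C) X Y : C :=
  X (eta Y) - Y (eta X) - eta (bracket X Y).

Definition nijenhuis (phi : X_M -> X_M) X Y : X_M :=
  phi (phi (bracket X Y)) + bracket (phi X) (phi Y)
  - phi (bracket (phi X) Y) - phi (bracket X (phi Y)).

Definition normal (S : almost_paracontact_metric) : Prop :=
  forall X Y, nijenhuis (phi S) X Y - two_d_eta (eta S) X Y *: xi S = 0.

Definition connection (nabla : X_M -> X_M -> X_M) : Prop :=
  [/\ forall Y, linear (nabla^~ Y),
      forall X Y Z, nabla X (Y + Z) = nabla X Y + nabla X Z &
      forall X f Y, nabla X (f *: Y) = (X f : C) *: Y + f *: nabla X Y].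

Definition torsion_free (nabla : X_M -> X_M -> X_M) : Prop :=
  forall X Y, nabla X Y - nabla Y X = bracket X Y.

Definition parallel (nabla : X_M -> X_M -> X_M) (T : X_M -> X_M -> C) : Prop :=
  forall X Y Z, X (T Y Z) - T (nabla X Y) Z - T Y (nabla X Z) = 0.

Definition levi_civita (g : X_M -> X_M -> C) (nabla : X_M -> X_M -> X_M) :
    Prop :=
  [/\ connection nabla, torsion_free nabla & parallel nabla g].

(* a and b are the functions alpha and beta attached to a normal structure;
   they are unique, with 2 a = tr (X |-> nabla_X xi) and
   2 b = tr (X |-> phi (nabla_X xi)). *)
Definition normal_functions (S : almost_paracontact_metric)
    (nabla : X_M -> X_M -> X_M) (a b : C) : Prop :=
  forall X, nabla X (xi S) = a *: (X - eta S X *: xi S) + b *: phi S X.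

Definition para_kenmotsu (S : almost_paracontact_metric)
    (nabla : X_M -> X_M -> X_M) (alpha : R) : Prop :=
  [/\ normal S, alpha != 0 & normal_functions S nabla (alpha *: (1 : C)) 0].

End Tensors.

(* Main.v *)
(* From nabla_X xi = alpha (X - eta(X) xi) one gets the curvature
   R(X, Y) xi = alpha^2 (eta(X) Y - eta(Y) X), which constrains parallel tensors
   through the Ricci identity.  For the skew part A of T, the identity and the
   first Bianchi identity give eta /\ A = 0, so A = eta /\ w with w = A(xi, .);
   then nabla A = 0 says h(X, .) /\ w = 0 for the transverse metric
   h = g - eta (x) eta, which forces w = 0 as h has rank 2.  So T is symmetric,
   and the Ricci identity on (xi, xi) gives T(Y, xi) = T(xi, xi) eta(Y).
   Differentiating this gives T = T(xi, xi) g, where T(xi, xi) is annihilated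
   by all vector fields, hence constant since M is connected. *)
Require Import Defs.
From mathcomp Require Import all_boot all_order all_algebra.
From mathcomp Require Import all_classical all_reals all_analysis.
From mathcomp Require Import ring.

Set Implicit Arguments.
Unset Strict Implicit.
Unset Printing Implicit Defensive.

Import Order.TTheory GRing.Theory Num.Theory.
Import numFieldNormedType.Exports.

Local Open Scope ring_scope.

(** * Calculus of vector fields, (0,2)-tensors and connections; Ricci and Bianchi identities *)

Section Fields.
Variables (R : realType) (M : manifold3 R).
Implicit Types (X Y Z : vfield M) (f u : Cinf M).

Lemma vfield_ext X Y : (forall u, X u = Y u) -> X = Y.
Proof. by move=> XY; apply/val_inj/funext. Qed.

(** Presents the coercion as the subtype projection [val], to which the generic morphism lemmas
    apply. *)
Lemma vfield_funE X : vfield_fun X = val X. Proof. by []. Qed.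

Lemma vfield_addE X Y u : (X + Y) u = X u + Y u.
Proof.
rewrite !vfield_funE.
by rewrite (raddfD (val : vfield M -> (Cinf M -> (Cinf M)^o)) X Y).
Qed.

Lemma vfield_scaleE f X u : (f *: X) u = f * (X u : Cinf M).
Proof. by rewrite !vfield_funE GRing.valZ. Qed.

Lemma vfield_oppE X u : (- X) u = - (X u : Cinf M).
Proof. by rewrite -scaleN1r vfield_scaleE mulN1r. Qed.

Lemma vfield_zeroE u : (0 : vfield M) u = 0.
Proof. by rewrite -(scale0r 0) vfield_scaleE mul0r. Qed.

Definition vfieldE := (vfield_addE, vfield_oppE, vfield_scaleE, vfield_zeroE).

Lemma bracketE X Y u : bracket X Y u = (X (Y u) : Cinf M) - Y (X u).
Proof. by []. Qed.

Lemma vfieldD X (f u : Cinf M) : X (f + u) = X f + X u.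
Proof.
by have /set_mem[XL _] := vfieldP X; have := XL 1 f u; rewrite !scale1r.
Qed.

Lemma vfieldM X (f u : Cinf M) :
  X (f * u) = f * (X u : Cinf M) + u * (X f : Cinf M).
Proof. by have /set_mem[_ XM] := vfieldP X. Qed.

Lemma vfieldZ X (a : R) f : X (a *: f) = a *: (X f : Cinf M).
Proof.
have /set_mem[XL _] := vfieldP X; have := XL a f 0.
rewrite !addr0 => ->; have := XL (-1) 0 0.
by rewrite scaler0 addr0 scaleN1r addNr => ->; rewrite addr0.
Qed.

Lemma vfieldN X f : X (- f) = - (X f : Cinf M).
Proof. by rewrite -scaleN1r vfieldZ scaleN1r. Qed.

Lemma vfieldB X (f u : Cinf M) : X (f - u) = (X f : Cinf M) - X u.
Proof. by rewrite vfieldD vfieldN. Qed.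

Lemma vfield1 X : X 1 = 0 :> Cinf M.
Proof.
have := vfieldM X 1 1; rewrite !mul1r => e.
by rewrite -[RHS](subrr (X 1 : Cinf M)) {2}e addrK.
Qed.

Lemma vfield_cst X (a : R) : X (a *: (1 : Cinf M)) = 0 :> Cinf M.
Proof. by rewrite vfieldZ vfield1 scaler0. Qed.

Lemma Cinf_scale_eq0 (a : R) f : a != 0 -> a *: f = 0 -> f = 0.
Proof. by move=> a0 e; rewrite -[f]scale1r -(mulVf a0) -scalerA e scaler0. Qed.

Lemma Cinf_double_eq0 f : f + f = 0 -> f = 0.
Proof.
move=> e; apply: (@Cinf_scale_eq0 2%:R); first by rewrite pnatr_eq0.
by rewrite scaler_nat mulr2n.
Qed.

Section Tensor.
Variable T : vfield M -> vfield M -> Cinf M.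
Hypothesis T_tensor : tensor02 T.

Lemma tensorDl X Y Z : T (X + Y) Z = T X Z + T Y Z.
Proof. by have := T_tensor.1 Z 1 X Y; rewrite !scale1r. Qed.
Lemma tensorDr X Y Z : T X (Y + Z) = T X Y + T X Z.
Proof. by have := T_tensor.2 X 1 Y Z; rewrite !scale1r. Qed.
Lemma tensor0l Z : T 0 Z = 0.
Proof. by apply: (addIr (T 0 Z)); rewrite -tensorDl !add0r. Qed.
Lemma tensor0r Z : T Z 0 = 0.
Proof. by apply: (addIr (T Z 0)); rewrite -tensorDr !add0r. Qed.
Lemma tensorZl f X Y : T (f *: X) Y = f * T X Y.
Proof.
by have := T_tensor.1 Y f X 0; rewrite !addr0 tensor0l => ->; rewrite addr0.
Qed.
Lemma tensorZr f X Y : T X (f *: Y) = f * T X Y.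
Proof.
by have := T_tensor.2 X f Y 0; rewrite !addr0 tensor0r => ->; rewrite addr0.
Qed.
Lemma tensorNl X Y : T (- X) Y = - T X Y.
Proof. by rewrite -scaleN1r tensorZl mulN1r. Qed.
Lemma tensorNr X Y : T X (- Y) = - T X Y.
Proof. by rewrite -scaleN1r tensorZr mulN1r. Qed.
Definition tensorE := (tensorDl, tensorDr, tensorNl, tensorNr,
  tensorZl, tensorZr).

End Tensor.

Lemma tensor02_skew T : tensor02 T ->
  tensor02 (fun X Y : vfield M => T X Y - T Y X).
Proof.
move=> tT; split=> [Y|X] a U V /=;
  rewrite !(tensorE tT) -[_ *: _]/(_ * _); ring.
Qed.

Variable nabla : vfield M -> vfield M -> vfield M.

Lemma parallelE T X Y Z : parallel nabla T ->
  X (T Y Z) = T (nabla X Y) Z + T Y (nabla X Z).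
Proof.
by move=> TP; apply/eqP; rewrite -subr_eq0 opprD addrA; apply/eqP/(TP X Y Z).
Qed.

Lemma parallel_skew (T : vfield M -> vfield M -> Cinf M) :
  parallel nabla T -> parallel nabla (fun X Y => T X Y - T Y X).
Proof.
move=> pT X Y Z; rewrite vfieldB (parallelE X Y Z pT) (parallelE X Z Y pT).
ring.
Qed.

Definition curvature X Y Z : vfield M :=
  nabla X (nabla Y Z) - nabla Y (nabla X Z) - nabla (bracket X Y) Z.

(** [bracket X Y (T Z W)] is computed directly and as a commutator of derivatives; parallelism moves
    every derivative inside [T], and the mixed terms cancel. *)
Lemma ricci_identity T X Y Z W : tensor02 T -> parallel nabla T ->
  T (curvature X Y Z) W + T Z (curvature X Y W) = 0.
Proof.
move=> tT pT.
have E : bracket X Y (T Z W) = (X (Y (T Z W)) : Cinf M) - Y (X (T Z W)) by [].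
move: E; rewrite !(parallelE _ _ _ pT) !vfieldD !(parallelE _ _ _ pT).
rewrite /curvature !(tensorE tT) => E.
apply: etrans (subrr (T (nabla (bracket X Y) Z) W +
  T Z (nabla (bracket X Y) W))).
rewrite {1}E; ring.
Qed.

Lemma jacobi X Y Z : bracket X (bracket Y Z) + bracket Y (bracket Z X) +
  bracket Z (bracket X Y) = 0.
Proof.
by apply: vfield_ext => u; rewrite !vfieldE !bracketE !vfieldB; ring.
Qed.

Hypothesis nabla_connection : connection nabla.

Lemma connDl X Y Z : nabla (X + Y) Z = nabla X Z + nabla Y Z.
Proof.
by have [l _ _] := nabla_connection; have := l Z 1 X Y; rewrite !scale1r.
Qed.
Lemma connDr X Y Z : nabla X (Y + Z) = nabla X Y + nabla X Z.
Proof. by have [_ -> _] := nabla_connection. Qed.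
Lemma connZr X f Y : nabla X (f *: Y) = (X f : Cinf M) *: Y + f *: nabla X Y.
Proof. by have [_ _ ->] := nabla_connection. Qed.
Lemma connNr X Y : nabla X (- Y) = - nabla X Y.
Proof.
by rewrite -scaleN1r connZr vfieldN vfield1 oppr0 scale0r add0r scaleN1r.
Qed.
Lemma connZl f X Y : nabla (f *: X) Y = f *: nabla X Y.
Proof.
have [l _ _] := nabla_connection.
have n0 : nabla 0 Y = 0 by apply: (addIr (nabla 0 Y)); rewrite -connDl !add0r.
by have := l Y f X 0; rewrite addr0 n0 => ->; rewrite addr0.
Qed.
Lemma connNl X Y : nabla (- X) Y = - nabla X Y.
Proof. by rewrite -scaleN1r connZl scaleN1r. Qed.

Hypothesis nabla_torsion_free : torsion_free nabla.

(** Once torsion-freeness replaces each bracket by a commutator of [nabla], this is the Jacobi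
    identity. *)
Lemma bianchi X Y Z :
  curvature X Y Z + curvature Y Z X + curvature Z X Y = 0.
Proof.
have t U V W :
    nabla W (bracket U V) - nabla (bracket U V) W = bracket W (bracket U V).
  exact: nabla_torsion_free.
rewrite -(jacobi X Y Z) -!t -!nabla_torsion_free /curvature.
rewrite -!nabla_torsion_free !(connDr, connNr, connDl, connNl).
apply: vfield_ext => u; rewrite !vfieldE; ring.
Qed.

End Fields.

(** * Algebra of the structure tensors and the transverse metric *)

Section AlmostParacontact.
Variables (R : realType) (M : manifold3 R) (S : almost_paracontact_metric M).
Implicit Types X Y Z : vfield M.
Notation "'ξ'" := (xi S).
Notation "'η' X" := (eta S X : Cinf M) (at level 10, X at level 9).
Notation "'φ' X" := (phi S X) (at level 10, X at level 9).
Notation g := (g S).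

Lemma g_tensor : tensor02 g. Proof. by have [] := g_metric S. Qed.
Lemma g_sym X Y : g X Y = g Y X. Proof. by have [] := g_metric S. Qed.

Lemma etaZ (f : Cinf M) X : η (f *: X) = f * η X.
Proof. by rewrite linearZ. Qed.

(** The cube of [phi] is computed as [φ (φ (φ X))] with [phi_sqr] applied outside and inside. *)
Lemma eta_phi_xi X : η (φ X) *: ξ = η X *: φ ξ.
Proof.
have := phi_sqr S (φ X); rewrite (phi_sqr S X) linearB linearZ /=.
by move=> /addrI /oppr_inj.
Qed.

(** With [f = η (φ ξ)], [eta_phi_xi] gives [φ ξ = f *: ξ], so [φ (φ ξ) = 0] reads [f * f = 0], which
    is solved at each point. *)
Lemma phi_xi : φ ξ = 0.
Proof.
have e := eta_phi_xi ξ; rewrite eta_xi scale1r in e.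
suff f0 : η (φ ξ) = 0 by rewrite -e f0 scale0r.
have := phi_sqr S ξ; rewrite eta_xi scale1r subrr -{1}e linearZ /= -e.
move/(congr1 (eta S)); rewrite linear0 !etaZ eta_xi mulr1 => f2.
apply: CinfP => p; move: (congr1 (fun f : Cinf M => f p) f2).
by rewrite CinfM !Cinf0 => /eqP; rewrite mulf_eq0 orbb => /eqP.
Qed.

Lemma eta_phi X : η (φ X) = 0.
Proof.
have := eta_phi_xi X; rewrite phi_xi scaler0.
by move/(congr1 (eta S)); rewrite linear0 etaZ eta_xi mulr1.
Qed.

Lemma g_xi X : g X ξ = η X.
Proof.
have := g_phi S X ξ.
rewrite phi_xi (tensor0r g_tensor) eta_xi mulr1 => /eqP.
by rewrite eq_sym addrC subr_eq0 => /eqP.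
Qed.

(** The restriction of [g] to the kernel of [eta], extended by zero along [ξ]; by [g_phi] it equals
    [- g (φ X) (φ Y)]. *)
Definition transverse_metric X Y : Cinf M := g X Y - η X * η Y.

Lemma transverse_metric_phi X Y :
  transverse_metric (φ X) (φ Y) = - transverse_metric X Y.
Proof. by rewrite /transverse_metric g_phi !eta_phi mulr0 subr0 opprB addrC. Qed.

(* A rank-one form of either sign is definite, whereas [phi] changes the sign
   of the transverse metric, and the latter vanishes at no point: it is at most
   [-1] on the negative vector of an orthonormal frame. *)
Lemma transverse_metric_rank_gt1 (w : vfield M -> Cinf M) :
  (forall X Y Z, transverse_metric X Y * w Z = transverse_metric X Z * w Y) ->
  forall Z, w Z = 0.
Proof.
move=> hw Z; apply: CinfP => p; rewrite Cinf0; apply/eqP/negPn/negP => wZ.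
(* At [p], [hw] makes each [h X] proportional to [w]; by symmetry [h] is a multiple of the square of
   [w], and the pair [(Z, Z)] determines the factor [c]. *)
pose h X Y := transverse_metric X Y p; pose c := h Z Z / w Z p ^+ 2.
have hwp A B D : h A B * w D p = h A D * w B p.
  by have := congr1 (fun f : Cinf M => f p) (hw A B D); rewrite !CinfM.
have hsym A B : h A B = h B A.
  by rewrite /h /transverse_metric g_sym mulrC.
have rank1 A B : h A B = c * w A p * w B p.
  have e1 := hwp A B Z; have e2 := hwp Z A Z; rewrite hsym in e2.
  apply: (mulIf (expf_neq0 2 wZ)); rewrite /c.
  transitivity ((h A B * w Z p) * w Z p); first by ring.
  rewrite e1 -mulrA [w B p * _]mulrC mulrA e2.
  by field.
have neg A B : h (φ A) (φ B) = - h A B.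
  by have := congr1 (fun f : Cinf M => f p) (transverse_metric_phi A B).
(* [neg Z Z] equates [c] times a square with [- c] times a nonzero square. *)
have c0 : c = 0.
  have := neg Z Z; rewrite !rank1 => e.
  have {e} : c * (w (φ Z) p ^+ 2 + w Z p ^+ 2) = 0.
    by rewrite mulrDr !expr2 !mulrA e addNr.
  move/eqP; rewrite mulf_eq0 => /orP[/eqP//|].
  by rewrite paddr_eq0 ?sqr_ge0// !sqrf_eq0 (negbTE wZ) andbF.
have [_ _ /(_ p)[E _ gE]] := g_metric S.
have := rank1 (E ord_max) (E ord_max).
rewrite c0 !mul0r /h /transverse_metric CinfB CinfM gE eqxx /= => /eqP.
rewrite subr_eq0 => /eqP e; have := sqr_ge0 ((η (E ord_max)) p).
by rewrite expr2 -e oppr_ge0 ler10.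
Qed.

(** * Parallel tensors on an alpha-para Kenmotsu manifold *)

Variable nabla : vfield M -> vfield M -> vfield M.
Hypothesis nabla_LC : levi_civita g nabla.
Variable alpha : R.
Hypothesis S_para_kenmotsu : para_kenmotsu S nabla alpha.
Let k : Cinf M := alpha *: (1 : Cinf M).

Lemma nabla_xi X : nabla X ξ = k *: (X - η X *: ξ).
Proof. by have [_ _ ->] := S_para_kenmotsu; rewrite scale0r addr0. Qed.

Lemma alpha_mul_inj (f : Cinf M) : k * f = 0 -> f = 0.
Proof.
have [_ a0 _] := S_para_kenmotsu => e; apply: (Cinf_scale_eq0 a0).
by rewrite -e /k; apply: CinfP => p; rewrite !CinfE; ring.
Qed.

(** Differentiate [η Y = g Y ξ] with [g] parallel: the covariant derivative of [eta] is alpha times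
    the transverse metric. *)
Lemma nabla_eta X Y :
  X (η Y) = η (nabla X Y) + k * transverse_metric X Y.
Proof.
have [_ _ gP] := nabla_LC; rewrite -(g_xi Y) (parallelE X Y ξ gP) g_xi nabla_xi.
rewrite !(tensorE g_tensor) g_xi /transverse_metric (g_sym Y X); ring.
Qed.

(** [eta] is closed, its covariant derivative being symmetric. *)
Lemma eta_bracket X Y : η (bracket X Y) = (X (η Y) : Cinf M) - Y (η X).
Proof.
have [_ tf _] := nabla_LC; rewrite -tf linearB /= !nabla_eta.
rewrite /transverse_metric (g_sym Y X); ring.
Qed.

(** In the expansion by [nabla_xi], derivatives of [k] vanish as alpha is constant, and the terms
    differentiating [eta] cancel as [eta] is closed. *)
Lemma curvature_xi X Y :
  curvature nabla X Y ξ = (k * k) *: (η X *: Y - η Y *: X).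
Proof.
have [nc tf _] := nabla_LC.
rewrite /curvature !nabla_xi !(connZr nc) !(connDr nc) !(connNr nc) !(connZr nc).
rewrite !nabla_xi eta_bracket -tf /k !vfield_cst.
by apply: vfield_ext => u; rewrite !vfieldE; ring.
Qed.

(* The Ricci identity on [(Z, xi)], summed cyclically: the terms
   [A (curvature X Y Z) xi] cancel by the Bianchi identity. *)
Lemma skew_parallel_eta_wedge A X Y Z :
  tensor02 A -> parallel nabla A -> (forall X Y, A X Y = - A Y X) ->
  η X * A Y Z + η Y * A Z X + η Z * A X Y = 0.
Proof.
move=> tA pA sA; have [nc tf _] := nabla_LC.
have r U V W : k * (k * (η U * A W V - η V * A W U)) =
    - A (curvature nabla U V W) ξ.
  have := ricci_identity U V W ξ tA pA.
  rewrite curvature_xi !(tensorE tA) => /eqP.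
  by rewrite addr_eq0 => /eqP ->; ring.
have b : A (curvature nabla X Y Z) ξ + A (curvature nabla Y Z X) ξ
    + A (curvature nabla Z X Y) ξ = 0.
  by rewrite -!(tensorDl tA) (bianchi nc tf) (tensor0l tA).
(* By skewness each wedge term occurs twice in the cyclic sum, always with the factor [k * k]. *)
apply: Cinf_double_eq0; apply: alpha_mul_inj; apply: alpha_mul_inj.
rewrite -b -[A (curvature nabla X Y Z) ξ]opprK -[A (curvature nabla Y Z X) ξ]opprK.
rewrite -[A (curvature nabla Z X Y) ξ]opprK -!r.
by rewrite (sA Y X) (sA Z Y) (sA Z X); ring.
Qed.

Lemma skew_parallel_eq0 A :
  tensor02 A -> parallel nabla A -> (forall X Y, A X Y = - A Y X) ->
  forall X Y, A X Y = 0.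
Proof.
move=> tA pA sA.
have xx X : A X X = 0.
  by apply: Cinf_double_eq0; rewrite {1}sA addNr.
pose w := A ξ.
(* This is the wedge relation with [ξ] in the first slot. *)
have Aw X Y : A X Y = η X * w Y - η Y * w X.
  have := skew_parallel_eta_wedge ξ X Y tA pA sA.
  rewrite eta_xi mul1r => e; rewrite -[LHS]subr0 -e /w (sA Y ξ); ring.
suff w0 : forall Z, w Z = 0 by move=> X Y; rewrite Aw !w0 !mulr0 subrr.
have wxi : w ξ = 0 by exact: xx.
apply: transverse_metric_rank_gt1 => X Y Z.
have pw (U V : vfield M) : U (w V) = A (k *: (U - η U *: ξ)) V + w (nabla U V).
  by rewrite /w (parallelE _ _ _ pA) nabla_xi.
(* By [Aw], the covariant derivative of [w] along [X] is [- k * w X] times [eta]. Its contributions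
   to that of the wedge of [eta] and [w] cancel, leaving [k] times the desired difference. *)
have := parallelE X Y Z pA.
rewrite (Aw Y Z) vfieldB !vfieldM !nabla_eta !pw !(tensorE tA) => e.
apply/eqP; rewrite -subr_eq0; apply/eqP; apply: alpha_mul_inj.
move: e; rewrite (Aw (nabla X Y)) (Aw Y (nabla X Z)) (Aw X Z) (Aw X Y)
  -/(w Z) -/(w Y) => e.
apply: etrans (subrr (η (nabla X Y) * w Z - η Z * w (nabla X Y)
  + (η Y * w (nabla X Z) - η (nabla X Z) * w Y))).
rewrite -{1}e; ring.
Qed.

Lemma sym_parallel_metric B :
  tensor02 B -> parallel nabla B -> (forall X Y, B X Y = B Y X) ->
  (forall X Y, B X Y = B ξ ξ * g X Y) /\ forall X, X (B ξ ξ) = 0 :> Cinf M.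
Proof.
move=> tB pB sB.
have Bxi Y : B Y ξ = η Y * B ξ ξ.
  have := ricci_identity ξ Y ξ ξ tB pB.
  rewrite curvature_xi eta_xi !(tensorE tB) (sB ξ Y) => e.
  apply/eqP; rewrite -subr_eq0; apply/eqP.
  (* The two Ricci terms agree by symmetry, each carrying the factor [k * k]. *)
  apply: Cinf_double_eq0; apply: alpha_mul_inj; apply: alpha_mul_inj.
  by rewrite -e; ring.
(* [nabla X ξ] lies in the kernel of [eta], where [Bxi] makes [B _ ξ] vanish. *)
have dB X : X (B ξ ξ) = 0.
  rewrite (parallelE _ _ _ pB) nabla_xi !(tensorE tB) (sB ξ X) (Bxi X); ring.
split=> // X Y; apply/eqP; rewrite -subr_eq0; apply/eqP; apply: alpha_mul_inj.
(* Differentiating [Bxi] along [X] brings in [B Y X] through [nabla X ξ] and the transverse metric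
   through [nabla_eta]. *)
have := parallelE X Y ξ pB.
rewrite (Bxi Y) vfieldM dB nabla_eta nabla_xi !(tensorE tB).
rewrite (Bxi (nabla X Y)) (Bxi Y) (sB Y X) => /eqP.
rewrite eq_sym -subr_eq0 => /eqP e; rewrite -[RHS]e /transverse_metric; ring.
Qed.

End AlmostParacontact.

(** * From vanishing derivatives to constant functions *)

Local Open Scope classical_set_scope.

(** The mean value theorem on the segment from [x] to [y], which stays in the ball. *)
Lemma derive0_ball_cst (R : realType) (n : nat) (F : 'rV[R]_n.+1 -> R)
    (x y : 'rV[R]_n.+1) (e : R) :
  (forall z, ball x e z -> forall v, is_derive z v F 0) ->
  ball x e y -> F y = F x.
Proof.
move=> dF xy; pose f t := F (x + t *: (y - x)).
have df (t : R) : 0 <= t <= 1 -> is_derive t 1 f 0.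
  move=> /andP[t0 t1].
  have xz : ball x e (x + t *: (y - x)).
    move: xy; rewrite -!ball_normE /= opprD addrA subrr sub0r normrN normrZ.
    rewrite ger0_norm// distrC; apply: le_lt_trans.
    by rewrite ler_piMl.
  have [d <-] := dF _ xz (y - x).
  (* The difference quotients of [f] at [t] are those of [F] in the direction [y - x], so only
     directional derivatives of [F] enter. *)
  have E : (fun h : R => h^-1 *: ((f \o shift t) (h *: 1) - f t)) =
      fun h : R => h^-1 *: ((F \o shift (x + t *: (y - x))) (h *: (y - x)) -
                   F (x + t *: (y - x))).
    apply/funext => h; rewrite /f /= [h *: (1 : R)]mulr1.
    by rewrite scalerDl addrCA.
  apply: DeriveDef; first by rewrite /derivable E.
  by rewrite /derive E.
have cf : {within `[0, 1], continuous f}.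
  by apply: derivable_within_continuous => t; rewrite in_itv /= => /df[].
have [|t _] := MVT (@ltr01 R) _ cf (df := cst 0).
  move=> t; rewrite in_itv /= => /andP[/ltW t0 /ltW t1].
  by apply: df; rewrite t0.
rewrite /= mul0r /f scale0r addr0 scale1r [x + (y - x)]addrC subrK => /eqP.
by rewrite subr_eq0 => /eqP.
Qed.

(** Every preimage under [h] is open, so each fibre is also closed, as the complement of a
    preimage. *)
Lemma locally_cst_connected (T : topologicalType) (S : Type) (h : T -> S) :
  connected [set: T] -> (forall p, \forall q \near p, h q = h p) ->
  forall p q, h p = h q.
Proof.
move=> conn loc p q.
have op (D : set S) : open (h @^-1` D).
  by rewrite openE => r Dr; apply: filterS (loc r) => s /= ->.
suff /(congr1 (fun D : set T => D q)) : h @^-1` [set h p] = setT.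
  by move=> /= e; symmetry; rewrite e.
apply: conn; first by exists p.
  by exists (h @^-1` [set h p]); rewrite ?setTI.
exists (h @^-1` [set h p]); rewrite ?setTI// -[X in closed X]setCK.
by apply: open_closedC; rewrite preimage_setC.
Qed.

Section Constancy.
Variables (R : realType) (M : manifold3 R).
Implicit Types (c : chart R M) (p : M) (f u : Cinf M).

Lemma tangent_funE p (v : tangent p) : tangent_fun v = val v. Proof. by []. Qed.

Lemma tangent_addE p (v w : tangent p) u : (v + w) u = v u + w u.
Proof.
by rewrite !tangent_funE (raddfD (val : tangent p -> (Cinf M -> R^o)) v w).
Qed.

Lemma tangent_scaleE p (a : R) (v : tangent p) u : (a *: v) u = a * (v u : R).
Proof. by rewrite !tangent_funE GRing.valZ. Qed.

Lemma tangent_zeroE p u : (0 : tangent p) u = 0.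
Proof. by rewrite -(scale0r 0) tangent_scaleE mul0r. Qed.

Lemma smooth_chart_derivable f c p v : atlas c -> chart_dom c p ->
  derivable (f \o chart_inv c) (chart_map c p) v.
Proof.
move=> ac cp; have /set_mem/(_ c ac 1%N)[_ /(_ v)[d _]] := Cinf_smooth f.
by apply: d; apply/mem_set; exists p.
Qed.

Lemma chart_derivation_subproof c p v : atlas c -> chart_dom c p ->
  (fun f : Cinf M => 'D_v (f \o chart_inv c) (chart_map c p)) \in tangent_pred p.
Proof.
move=> ac cp; have d f := smooth_chart_derivable (f := f) (v := v) ac cp.
have ip : chart_inv c (chart_map c p) = p by apply: chart_mapK; apply/mem_set.
rewrite inE; split=> [a f u|f u].
  rewrite (_ : _ \o _ = a *: (f \o chart_inv c) + (u \o chart_inv c)) //.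
  by rewrite deriveD ?deriveZ//; apply: derivableZ.
rewrite (_ : _ \o _ = (f \o chart_inv c) * (u \o chart_inv c)) //.
by rewrite deriveM//= ip.
Qed.

Definition chart_derivation c p v (ac : atlas c) (cp : chart_dom c p) :
  tangent p := MkTangent (chart_derivation_subproof v ac cp).

(* Tangent vectors are combinations of values of global vector fields, so the
   partial derivatives in a chart are controlled without bump functions. *)
Lemma tangent_eq0 f p (v : tangent p) (E : 'I_3 -> vfield M) :
  frame_at p E -> (forall X : vfield M, X f = 0) -> v f = 0.
Proof.
move=> /(_ v)[a [-> _]] f0.
elim/big_ind: _ => [|s t s0 t0|i _]; first exact: tangent_zeroE.
  by rewrite tangent_addE s0 t0 addr0.
by rewrite tangent_scaleE /= f0 mulr0.
Qed.

(** Read in a chart, the directional derivatives of [f] are tangent vectors applied to [f], hence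
    zero on a ball around the image of [p]; continuity of the chart brings constancy back to [M]. *)
Lemma flat_locally_cst f :
  (forall p, exists E : 'I_3 -> vfield M, frame_at p E) ->
  (forall X : vfield M, X f = 0) ->
  forall p, \forall q \near p, f q = f p.
Proof.
move=> frames f0 p; have [c ac cp] := atlas_cover p.
have pU : (chart_map c @` chart_dom c) (chart_map c p) by exists p.
have [e /= e0 eU] :=
  (nbhs_ballP _ _).1 (open_nbhs_nbhs (conj (chart_cod_open c) pU)).
have near_ball : \forall q \near p, ball (chart_map c p) e (chart_map c q).
  apply: (chart_map_continuous (mem_set cp)); exact: nbhsx_ballx.
have near_dom : \forall q \near p, chart_dom c q.
  by apply: open_nbhs_nbhs; split=> //; exact: chart_dom_open.
near=> q.
have cq : chart_dom c q by near: q.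
have iE r : chart_dom c r -> f r = (f \o chart_inv c) (chart_map c r).
  by move=> cr /=; rewrite chart_mapK//; exact/mem_set.
rewrite !iE//; apply: (@derive0_ball_cst _ _ _ _ _ e); last by near: q.
move=> _ /eU[r cr <-] v; apply: DeriveDef.
  exact: smooth_chart_derivable.
have [E frE] := frames r.
exact: (tangent_eq0 (chart_derivation v ac cr) frE f0).
Unshelve. all: by end_near. Qed.

Lemma flat_cst f :
  (forall p, exists E : 'I_3 -> vfield M, frame_at p E) ->
  (forall X : vfield M, X f = 0) -> exists a : R, f = a *: (1 : Cinf M).
Proof.
(* Connectedness does not exclude the empty manifold, where any constant serves. *)
move=> frames f0; have [[p _]|M0] := pselect ([set: M] !=set0).
  exists (f p); apply: CinfP => q; rewrite CinfZ Cinf1 mulr1.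
  apply: locally_cst_connected q p; first exact: manifold_connected.
  exact: flat_locally_cst.
by exists 0; apply: CinfP => q; case: M0; exists q.
Qed.

End Constancy.
Local Close Scope classical_set_scope.

Theorem theorem3p1 (R : realType) (M : manifold3 R)
    (S : almost_paracontact_metric M)
    (nabla : vfield M -> vfield M -> vfield M)
    (nabla_LC : levi_civita (g S) nabla)
    (alpha : R) (S_para_kenmotsu : para_kenmotsu S nabla alpha)
    (T : vfield M -> vfield M -> Cinf M) (T_tensor : tensor02 T)
    (T_parallel : parallel nabla T) :
  exists c : R, forall X Y : vfield M, T X Y = c *: g S X Y.
Proof.
have T_sym X Y : T X Y = T Y X.
  apply/eqP; rewrite -subr_eq0; apply/eqP.
  apply: (skew_parallel_eq0 nabla_LC S_para_kenmotsu
    (tensor02_skew T_tensor) (parallel_skew T_parallel)) => Z W.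
  by rewrite opprB.
have [|Tg T_flat] :=
  sym_parallel_metric nabla_LC S_para_kenmotsu T_tensor T_parallel.
  exact: T_sym.
have [|c Tc] := flat_cst _ T_flat; last first.
  by exists c => X Y; rewrite Tg Tc; apply: CinfP => p; rewrite !CinfE mulr1.
(* The frames of global fields are the orthonormal ones given by the signature of [g]. *)
by move=> p; have [_ _ /(_ p)[E frE _]] := g_metric S; exists E.
Qed.
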